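(* Every finitely complete category that is both a Mal'tsev category and a majority category is protoarithmetical.
   Context: A binary relation between objects $X$ and $Y$ of a category is a triple $R=(R_0,r_1,r_2)$ with $r_1:R_0\to X$, $r_2:R_0\to Y$ jointly monomorphic; a pair $(x,y)$ of morphisms $x:S\to X$, $y:S\to Y$ is $R$-related if there is $f:S\to R_0$ with $r_1f=x$, $r_2f=y$. The relation $R$ is difunctional if for all $x_1,x_2:S\to X$ and $y_1,y_2:S\to Y$, if $(x_1,y_2)$, $(x_1,y_1)$ and $(x_2,y_1)$ are $R$-related then $(x_2,y_2)$ is $R$-related. A category is Mal'tsev if every internal binary relation in it is difunctional. A ternary relation between objects $A,B,C$ is a quadruple $R=(R_0,r_1,r_2,r_3)$ with $r_1:R_0\to A$, $r_2:R_0\to B$, $r_3:R_0\to C$ jointly monomorphic; a triple $(a,b,c)$ of morphisms $a:S\to A$, $b:S\to B$, $c:S\to C$ is $R$-related if there is $f:S\to R_0$ with $r_1f=a$, $r_2f=b$, $r_3f=c$. A category is a majority category if for any ternary relation $R$ between any objects $A,B,C$ and any morphisms $a_1,a_2:S\to A$, $b_1,b_2:S\to B$, $c_1,c_2:S\to C$: if $(a_1,b_1,c_2)$, $(a_1,b_2,c_1)$ and $(a_2,b_1,c_1)$ are $R$-related, then $(a_1,b_1,c_1)$ is $R$-related. A protoarithmetical category is a finitely complete Mal'tsev category in which every internal groupoid is an equivalence relation, i.e. for every internal groupoid the domain and codomain morphisms $d_0,d_1:G_1\to G_0$ are jointly monomorphic. *)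

(* Defs.v *)
(* Stdlib only. *)
From Stdlib Require Import List FinFun.

Set Implicit Arguments.
Unset Strict Implicit.
Unset Printing Implicit Defensive.

Record category := Category {
  obj :> Type;
  hom : obj -> obj -> Type;
  idm : forall X, hom X X;
  comp : forall X Y Z, hom Y Z -> hom X Y -> hom X Z;
  comp_idl : forall X Y (f : hom X Y), comp (idm Y) f = f;
  comp_idr : forall X Y (f : hom X Y), comp f (idm X) = f;
  comp_assoc : forall X Y Z W (h : hom Z W) (g : hom Y Z) (f : hom X Y),
    comp h (comp g f) = comp (comp h g) f
}.

Arguments hom {c} X Y.
Arguments idm {c} X.
Arguments comp {c X Y Z} g f.

Declare Scope cat_scope.
Delimit Scope cat_scope with cat.
Notation "g ∘ f" := (comp g f) (at level 40, left associativity) : cat_scope.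
Local Open Scope cat_scope.

Record functor (J C : category) := Functor {
  fobj :> J -> C;
  fmap : forall i j : J, hom i j -> hom (fobj i) (fobj j);
  fmap_id : forall i : J, fmap (idm i) = idm (fobj i);
  fmap_comp : forall (i j k : J) (g : hom j k) (f : hom i j),
    fmap (g ∘ f) = fmap g ∘ fmap f
}.

Definition finite_category (J : category) : Prop :=
  Finite J /\ forall i j : J, Finite (hom i j).

Definition is_cone (J C : category) (F : functor J C) (L : C)
    (p : forall j : J, hom L (F j)) : Prop :=
  forall (i j : J) (f : hom i j), fmap F f ∘ p i = p j.

Definition is_limit (J C : category) (F : functor J C) (L : C)
    (p : forall j : J, hom L (F j)) : Prop :=
  is_cone p /\
  forall (S : C) (q : forall j : J, hom S (F j)), is_cone q ->
    exists! u : hom S L, forall j : J, p j ∘ u = q j.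

Definition finitely_complete (C : category) : Prop :=
  forall J : category, finite_category J ->
  forall F : functor J C,
    exists (L : C) (p : forall j : J, hom L (F j)), is_limit p.

Definition jointly_mono2 (C : category) (R X Y : C)
    (r1 : hom R X) (r2 : hom R Y) : Prop :=
  forall (S : C) (u v : hom S R), r1 ∘ u = r1 ∘ v -> r2 ∘ u = r2 ∘ v -> u = v.

Definition jointly_mono3 (C : category) (R X Y Z : C)
    (r1 : hom R X) (r2 : hom R Y) (r3 : hom R Z) : Prop :=
  forall (S : C) (u v : hom S R),
    r1 ∘ u = r1 ∘ v -> r2 ∘ u = r2 ∘ v -> r3 ∘ u = r3 ∘ v -> u = v.

Record binary_relation (C : category) (X Y : C) := BinaryRelation {
  br_obj : C;
  br1 : hom br_obj X;
  br2 : hom br_obj Y;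
  br_mono : jointly_mono2 br1 br2
}.

Definition related2 (C : category) (X Y : C) (R : binary_relation X Y)
    (S : C) (x : hom S X) (y : hom S Y) : Prop :=
  exists f : hom S (br_obj R), br1 R ∘ f = x /\ br2 R ∘ f = y.

Definition difunctional (C : category) (X Y : C) (R : binary_relation X Y) : Prop :=
  forall (S : C) (x1 x2 : hom S X) (y1 y2 : hom S Y),
    related2 R x1 y2 -> related2 R x1 y1 -> related2 R x2 y1 -> related2 R x2 y2.

Definition maltsev (C : category) : Prop :=
  forall (X Y : C) (R : binary_relation X Y), difunctional R.

Record ternary_relation (C : category) (X Y Z : C) := TernaryRelation {
  tr_obj : C;
  tr1 : hom tr_obj X;
  tr2 : hom tr_obj Y;
  tr3 : hom tr_obj Z;
  tr_mono : jointly_mono3 tr1 tr2 tr3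
}.

Definition related3 (C : category) (X Y Z : C) (R : ternary_relation X Y Z)
    (S : C) (a : hom S X) (b : hom S Y) (c : hom S Z) : Prop :=
  exists f : hom S (tr_obj R), tr1 R ∘ f = a /\ tr2 R ∘ f = b /\ tr3 R ∘ f = c.

Definition majority (C : category) : Prop :=
  forall (X Y Z : C) (R : ternary_relation X Y Z) (S : C)
    (a1 a2 : hom S X) (b1 b2 : hom S Y) (c1 c2 : hom S Z),
    related3 R a1 b1 c2 -> related3 R a1 b2 c1 -> related3 R a2 b1 c1 ->
    related3 R a1 b1 c1.

Definition is_pullback (C : category) (X Y Z P : C) (f : hom X Z) (g : hom Y Z)
    (p : hom P X) (q : hom P Y) : Prop :=
  f ∘ p = g ∘ q /\
  forall (S : C) (x : hom S X) (y : hom S Y), f ∘ x = g ∘ y ->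
    exists! u : hom S P, p ∘ u = x /\ q ∘ u = y.

(* [ig_p1], [ig_p2] are the first and second arrow of a composable pair, and
   [ig_m] is their composite, in diagrammatic order.  The morphism <x, y> into
   the pullback [ig2] is denoted by any [u] with p1 u = x and p2 u = y; it is
   unique, so a law quantified over all such [u] is the law for <x, y>.
   Associativity is stated on generalized elements: for a composable triple
   x, y, z : S -> G1, it takes u = <x, y>, v = <y, z>, l = <m u, z> and
   r = <x, m v>. *)
Record internal_groupoid (C : category) := InternalGroupoid {
  ig0 : C;
  ig1 : C;
  ig2 : C;
  ig_d0 : hom ig1 ig0;
  ig_d1 : hom ig1 ig0;
  ig_e : hom ig0 ig1;
  ig_p1 : hom ig2 ig1;
  ig_p2 : hom ig2 ig1;
  ig_m : hom ig2 ig1;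
  ig_i : hom ig1 ig1;
  ig_pullback : is_pullback ig_d1 ig_d0 ig_p1 ig_p2;
  ig_d0_e : ig_d0 ∘ ig_e = idm ig0;
  ig_d1_e : ig_d1 ∘ ig_e = idm ig0;
  ig_d0_m : ig_d0 ∘ ig_m = ig_d0 ∘ ig_p1;
  ig_d1_m : ig_d1 ∘ ig_m = ig_d1 ∘ ig_p2;
  ig_assoc : forall (S : C) (u v l r : hom S ig2),
    ig_p2 ∘ u = ig_p1 ∘ v ->
    ig_p1 ∘ l = ig_m ∘ u -> ig_p2 ∘ l = ig_p2 ∘ v ->
    ig_p1 ∘ r = ig_p1 ∘ u -> ig_p2 ∘ r = ig_m ∘ v ->
    ig_m ∘ l = ig_m ∘ r;
  ig_unitl : forall u : hom ig1 ig2,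
    ig_p1 ∘ u = ig_e ∘ ig_d0 -> ig_p2 ∘ u = idm ig1 -> ig_m ∘ u = idm ig1;
  ig_unitr : forall u : hom ig1 ig2,
    ig_p1 ∘ u = idm ig1 -> ig_p2 ∘ u = ig_e ∘ ig_d1 -> ig_m ∘ u = idm ig1;
  ig_d0_i : ig_d0 ∘ ig_i = ig_d1;
  ig_d1_i : ig_d1 ∘ ig_i = ig_d0;
  ig_invr : forall u : hom ig1 ig2,
    ig_p1 ∘ u = idm ig1 -> ig_p2 ∘ u = ig_i -> ig_m ∘ u = ig_e ∘ ig_d0;
  ig_invl : forall u : hom ig1 ig2,
    ig_p1 ∘ u = ig_i -> ig_p2 ∘ u = idm ig1 -> ig_m ∘ u = ig_e ∘ ig_d1
}.

(* The remaining properties of an equivalence relation follow from the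
   groupoid structure. *)
Definition groupoid_is_equivalence_relation (C : category)
    (G : internal_groupoid C) : Prop :=
  jointly_mono2 (ig_d0 G) (ig_d1 G).

Definition protoarithmetical (C : category) : Prop :=
  finitely_complete C /\ maltsev C /\
  forall G : internal_groupoid C, groupoid_is_equivalence_relation G.

(* Main.v *)
Require Import Defs.

(** The theorem rests on a majority argument applied to composition.  In an
    internal groupoid, the triples (x, y, z) such that z is the composite of x
    and y form a ternary relation on the object of arrows.  If u is an
    endo-arrow, this relation contains (u, u, uu), (u, 1, u) and (1, u, u).
    A majority category therefore also has (u, u, u) in it, that is uu = u, and
    u = 1 by cancellation ([endo_arrow_is_identity]).  So every internal
    groupoid has only trivial endo-arrows.  For parallel arrows f and g, the
    composite of f with the inverse of g is an endo-arrow, so it is an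
    identity, and f = g: this is joint monicity of domain and codomain.

    Arrows are handled as generalized elements S -> G1, and everything about
    composition is phrased as relatedness for [composition_relation]. *)

Set Implicit Arguments.
Unset Strict Implicit.
Unset Printing Implicit Defensive.

Local Open Scope cat_scope.

Lemma is_pullback_jointly_mono (C : category) (X Y Z P : C)
    (f : hom X Z) (g : hom Y Z) (p : hom P X) (q : hom P Y) :
  is_pullback f g p q -> jointly_mono2 p q.
Proof.
  intros [Hc Hu] S u v Hp Hq.
  destruct (Hu S (p ∘ v) (q ∘ v)) as [w [_ Hw]].
  - rewrite !comp_assoc, Hc; reflexivity.
  - transitivity w; [symmetry|]; apply Hw; split; congruence.
Qed.

Section Composition.

Variables (C : category) (G : internal_groupoid C).

Lemma composition_jointly_mono : jointly_mono3 (ig_p1 G) (ig_p2 G) (ig_m G).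
Proof.
  intros S u v H1 H2 _.
  exact (is_pullback_jointly_mono (ig_pullback G) H1 H2).
Qed.

Definition composition_relation : ternary_relation (ig1 G) (ig1 G) (ig1 G) :=
  TernaryRelation composition_jointly_mono.

Notation composite := (related3 composition_relation).

Lemma composable_pair (S : C) (x y : hom S (ig1 G)) :
  ig_d1 G ∘ x = ig_d0 G ∘ y ->
  exists u : hom S (ig2 G), ig_p1 G ∘ u = x /\ ig_p2 G ∘ u = y.
Proof.
  intros H. destruct (proj2 (ig_pullback G) S x y H) as [u [Hu _]]. exists u; exact Hu.
Qed.

Lemma composite_exists (S : C) (x y : hom S (ig1 G)) :
  ig_d1 G ∘ x = ig_d0 G ∘ y -> exists z, composite x y z.
Proof.
  intros H. destruct (composable_pair H) as [u [H1 H2]].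
  exists (ig_m G ∘ u), u; auto.
Qed.

Lemma composite_unique (S : C) (x y z z' : hom S (ig1 G)) :
  composite x y z -> composite x y z' -> z = z'.
Proof.
  intros (u & H1 & H2 & H3) (v & K1 & K2 & K3). cbn in *.
  assert (u = v) by (apply (is_pullback_jointly_mono (ig_pullback G)); congruence).
  congruence.
Qed.

Lemma composite_composable (S : C) (x y z : hom S (ig1 G)) :
  composite x y z -> ig_d1 G ∘ x = ig_d0 G ∘ y.
Proof.
  intros (u & <- & <- & _). cbn.
  rewrite !comp_assoc, (proj1 (ig_pullback G)); reflexivity.
Qed.

Lemma composite_domain (S : C) (x y z : hom S (ig1 G)) :
  composite x y z -> ig_d0 G ∘ z = ig_d0 G ∘ x.
Proof.
  intros (u & <- & _ & <-). cbn. rewrite !comp_assoc, ig_d0_m; reflexivity.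
Qed.

Lemma composite_codomain (S : C) (x y z : hom S (ig1 G)) :
  composite x y z -> ig_d1 G ∘ z = ig_d1 G ∘ y.
Proof.
  intros (u & _ & <- & <-). cbn. rewrite !comp_assoc, ig_d1_m; reflexivity.
Qed.

Lemma composite_precomp (S T : C) (t : hom T S) (x y z : hom S (ig1 G)) :
  composite x y z -> composite (x ∘ t) (y ∘ t) (z ∘ t).
Proof.
  intros (u & <- & <- & <-). exists (u ∘ t). rewrite !comp_assoc; auto.
Qed.

(** The unit and inverse laws of an internal groupoid are laws about its
    generic arrow, the identity of G1; composing with x : S -> G1 transports
    them to x. *)
Lemma composite_unitl (S : C) (x : hom S (ig1 G)) :
  composite (ig_e G ∘ (ig_d0 G ∘ x)) x x.
Proof.
  destruct (@composable_pair _ (ig_e G ∘ ig_d0 G) (idm (ig1 G))) as [u [H1 H2]].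
  - rewrite comp_assoc, ig_d1_e, comp_idl, comp_idr; reflexivity.
  - assert (H : composite (ig_e G ∘ ig_d0 G) (idm _) (idm _))
      by (exists u; auto using ig_unitl).
    apply (composite_precomp x) in H.
    rewrite comp_idl, <- comp_assoc in H; exact H.
Qed.

Lemma composite_unitr (S : C) (x : hom S (ig1 G)) :
  composite x (ig_e G ∘ (ig_d1 G ∘ x)) x.
Proof.
  destruct (@composable_pair _ (idm (ig1 G)) (ig_e G ∘ ig_d1 G)) as [u [H1 H2]].
  - rewrite comp_assoc, ig_d0_e, comp_idl, comp_idr; reflexivity.
  - assert (H : composite (idm _) (ig_e G ∘ ig_d1 G) (idm _))
      by (exists u; auto using ig_unitr).
    apply (composite_precomp x) in H.
    rewrite comp_idl, <- comp_assoc in H; exact H.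
Qed.

Lemma composite_invr (S : C) (x : hom S (ig1 G)) :
  composite x (ig_i G ∘ x) (ig_e G ∘ (ig_d0 G ∘ x)).
Proof.
  destruct (@composable_pair _ (idm (ig1 G)) (ig_i G)) as [u [H1 H2]].
  - rewrite ig_d0_i, comp_idr; reflexivity.
  - assert (H : composite (idm _) (ig_i G) (ig_e G ∘ ig_d0 G))
      by (exists u; auto using ig_invr).
    apply (composite_precomp x) in H.
    rewrite comp_idl, <- comp_assoc in H; exact H.
Qed.

Lemma composite_invl (S : C) (x : hom S (ig1 G)) :
  composite (ig_i G ∘ x) x (ig_e G ∘ (ig_d1 G ∘ x)).
Proof.
  destruct (@composable_pair _ (ig_i G) (idm (ig1 G))) as [u [H1 H2]].
  - rewrite ig_d1_i, comp_idr; reflexivity.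
  - assert (H : composite (ig_i G) (idm _) (ig_e G ∘ ig_d1 G))
      by (exists u; auto using ig_invl).
    apply (composite_precomp x) in H.
    rewrite comp_idl, <- comp_assoc in H; exact H.
Qed.

Lemma composite_assoc (S : C) (x y z xy yz xyz : hom S (ig1 G)) :
  composite x y xy -> composite y z yz -> composite xy z xyz ->
  composite x yz xyz.
Proof.
  intros Hxy Hyz Hl.
  destruct (@composable_pair S x yz) as [r [R1 R2]].
  - rewrite (composite_domain Hyz). exact (composite_composable Hxy).
  - destruct Hxy as (u & U1 & U2 & U3), Hyz as (v & V1 & V2 & V3),
      Hl as (l & L1 & L2 & L3). cbn in *.
    exists r; cbn; repeat split; auto.
    rewrite <- L3; symmetry.
    apply (@ig_assoc _ G S u v l r); congruence.
Qed.

Lemma idempotent_arrow_is_identity (S : C) (u : hom S (ig1 G)) :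
  composite u u u -> u = ig_e G ∘ (ig_d0 G ∘ u).
Proof.
  intros H.
  (* Cancel u on the right in uu = u, using its inverse. *)
  pose proof (composite_assoc H (composite_invr u) (composite_invr u)) as K.
  rewrite <- (composite_composable H) in K at 1.
  exact (composite_unique (composite_unitr u) K).
Qed.

(** Each of the composition triples (u, u, uu), (u, 1, u) and (1, u, u) differs
    from (u, u, u) in one coordinate only, a different one each time, so the
    majority property makes u idempotent. *)
Lemma endo_arrow_is_identity (S : C) (u : hom S (ig1 G)) :
  majority C -> ig_d0 G ∘ u = ig_d1 G ∘ u -> u = ig_e G ∘ (ig_d0 G ∘ u).
Proof.
  intros HM Hu. apply idempotent_arrow_is_identity.
  destruct (composite_exists (eq_sym Hu)) as [uu Huu].
  exact (HM _ _ _ _ _ _ _ _ _ _ _ Huu (composite_unitr u) (composite_unitl u)).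
Qed.

End Composition.

Theorem majority_groupoid_is_equivalence_relation (C : category)
    (G : internal_groupoid C) :
  majority C -> groupoid_is_equivalence_relation G.
Proof.
  intros HM S f g H0 H1.
  assert (Hfg : ig_d1 G ∘ f = ig_d0 G ∘ (ig_i G ∘ g))
    by (rewrite comp_assoc, ig_d0_i; exact H1).
  destruct (composite_exists Hfg) as [u Hu].
  pose proof (composite_domain Hu) as D0.
  pose proof (composite_codomain Hu) as D1.
  rewrite comp_assoc, ig_d1_i in D1.
  assert (Eu : u = ig_e G ∘ (ig_d0 G ∘ g)).
  { rewrite (endo_arrow_is_identity HM (u := u)); congruence. }
  rewrite Eu in Hu.
  (* (f g^-1) g = 1 g = g because u = 1, while f (g^-1 g) = f 1 = f. *)
  pose proof (composite_assoc Hu (composite_invl g) (composite_unitl g)) as K.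
  rewrite <- H1 in K.
  exact (composite_unique (composite_unitr f) K).
Qed.

Theorem corollary1 (C : category) :
  finitely_complete C -> maltsev C -> majority C -> protoarithmetical C.
Proof.
  intros Hlim Hmal Hmaj. split; [exact Hlim|split; [exact Hmal|]].
  intros G. exact (majority_groupoid_is_equivalence_relation Hmaj).
Qed.
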